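(* Let $K$ be a field of characteristic $0$. The $2\times4$ multiplicity matrix \[M=\begin{pmatrix}2&1&0&0\\1&0&1&0\end{pmatrix}\] is not the multiplicity matrix of a polynomial: there exist no polynomial $f(x)\in K[x]$ and no sequence $\Lambda=(\lambda_1,\lambda_2)$ of distinct elements of $K$ with $M=M_f(\Lambda)$.
   Context: For a polynomial $f$ of degree $d$ and a sequence $\Lambda=(\lambda_1,\ldots,\lambda_m)$ of distinct elements of $K$, the multiplicity matrix $M_f(\Lambda)$ is the $m\times(d+1)$ matrix (rows $i\in\{1,\ldots,m\}$, columns $j\in\{0,\ldots,d\}$) whose $(i,j)$ entry is the multiplicity of $\lambda_i$ as a zero of the $j$th derivative $f^{(j)}(x)$ (which is $0$ if $f^{(j)}(\lambda_i)\neq0$). *)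

(* Defs.v *)
From HB Require Import structures.
From mathcomp Require Import all_boot all_order all_algebra.

Set Implicit Arguments.
Unset Strict Implicit.
Unset Printing Implicit Defensive.

Import GRing.Theory.
Local Open Scope ring_scope.

(* M_f(Lambda) for f of degree d: [mup x p] is the multiplicity of x as a zero
   of p, and [f^`(j)] is the j-th formal derivative.  Meaningful only when
   [size f = d.+1]; see [is_multiplicity_matrix]. *)
Definition multiplicity_matrix (K : fieldType) (m d : nat) (f : {poly K})
    (Lambda : m.-tuple K) : 'M[nat]_(m, d.+1) :=
  \matrix_(i < m, j < d.+1) mup (tnth Lambda i) f^`(j).

(* M = M_f(Lambda).  M_f(Lambda) has deg f + 1 columns, so the equality carries
   the requirement deg f = d. *)
Definition is_multiplicity_matrix (K : fieldType) (m d : nat)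
    (M : 'M[nat]_(m, d.+1)) (f : {poly K}) (Lambda : m.-tuple K) : Prop :=
  size f = d.+1 /\ M = multiplicity_matrix d f Lambda.

Definition M_2100_1010 : 'M[nat]_(2, 4) :=
  \matrix_(i < 2, j < 4)
    nth 0%N (nth [::] [:: [:: 2; 1; 0; 0]%N;
                          [:: 1; 0; 1; 0]%N] i) j.

(* Main.v *)
Require Import Defs.
From mathcomp Require Import all_boot all_order all_algebra.
From mathcomp Require Import ring.

Import GRing.Theory.
Local Open Scope ring_scope.

(** The first column of the matrix and [deg f = 3] force
    [f = c (X - a)^2 (X - b)], whose second derivative takes the value
    [4 c (b - a)] at [b]; this is nonzero in characteristic 0, whereas the
    matrix requires [b] to be a zero of [f'']. *)

Lemma mup_gt0_root (K : fieldType) (x : K) (p : {poly K}) :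
  (0 < mup x p)%N -> root p x.
Proof. by apply: contraTT => /mupNroot ->. Qed.

(** For distinct roots the two factors are coprime, so their product divides [f]; both have degree
    3, hence they agree up to a scalar. *)
Lemma cubic_double_simple_roots (K : fieldType) (f : {poly K}) (a b : K) :
  size f = 4%N -> a != b -> (2 <= mup a f)%N -> (1 <= mup b f)%N ->
  exists2 c : K, c != 0 & f = c *: (('X - a%:P) ^+ 2 * ('X - b%:P)).
Proof.
move=> szf neq_ab; have f0 : f != 0 by rewrite -size_poly_eq0 szf.
rewrite !mup_geq // expr1 => dva dvb.
have dvf : ('X - a%:P) ^+ 2 * ('X - b%:P) %| f.
  rewrite Gauss_dvdp ?dva //.
  by rewrite coprimep_expl // coprimep_XsubC root_XsubC eq_sym.
have /eqpfP : f %= ('X - a%:P) ^+ 2 * ('X - b%:P).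
  by rewrite eqp_sym -dvdp_size_eqp // szf size_Mmonic ?monicXsubC ?expf_neq0
    ?polyXsubC_eq0 // size_exp_XsubC size_XsubC.
(* The scalar is a ratio of leading coefficients; the product is monic, so it is [lead_coef f]. *)
rewrite lead_coef_Mmonic ?monicXsubC // lead_coef_exp lead_coefXsubC.
rewrite expr1n divr1 => fE.
by exists (lead_coef f); rewrite ?lead_coef_eq0.
Qed.

(** By Leibniz, only the cross term [2 * u' * v'] survives at [b], with [u = (X - a)^2] and
    [v = X - b]. *)
Lemma derivn2_cubic_double_simple_roots (K : fieldType) (a b c : K) :
  (c *: (('X - a%:P) ^+ 2 * ('X - b%:P)))^`(2).[b] = 4 * c * (b - a).
Proof.
rewrite derivnZ !derivSn derivn0 !derivE !hornerE /=.
ring.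
Qed.

Theorem theorem8 (K : fieldType) (charK0 : [pchar K] =i pred0) :
  ~ exists (f : {poly K}) (Lambda : 2.-tuple K),
      uniq Lambda /\ is_multiplicity_matrix M_2100_1010 f Lambda.
Proof.
move=> [f [L [uL [szf /matrixP ME]]]].
set a := tnth L ord0; set b := tnth L ord_max.
have neq_ab : a != b by rewrite /a /b !(tnth_nth 0) nth_uniq ?size_tuple.
have := ME ord0 ord0; rewrite !mxE -/a derivn0 /= => mua.
have := ME ord_max ord0; rewrite !mxE -/b derivn0 /= => mub.
(* Columns count from 0, so this entry, equal to 1, concerns [f''] at [b]. *)
have := ME ord_max (Ordinal (isT : (2 < 4)%N)); rewrite !mxE -/b => mub2.
have [||c c0 fE] := @cubic_double_simple_roots K f a b szf neq_ab.
- by rewrite -mua.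
- by rewrite -mub.
have : root f^`(2) b by apply: mup_gt0_root; rewrite -mub2.
rewrite fE /root derivn2_cubic_double_simple_roots !mulf_eq0 (negPf c0) orbF.
rewrite subr_eq0 [b == a]eq_sym (negPf neq_ab) orbF.
(* What remains is [4 = 0] in [K]. *)
by have /pcharf0P -> := charK0.
Qed.
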